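(* Let $\Delta$ be a nonpure strongly shellable simplicial complex and let $\succ$ be a strong shelling order on $\mathcal{F}(\Delta)$. Then every linear order $\succ'$ on $\mathcal{F}(\Delta)$ with $\operatorname{Inv}_{\succ}(\succ') \subseteq \operatorname{Inv}(\succ)$ is also a strong shelling order on $\mathcal{F}(\Delta)$.
   Context: A simplicial complex $\Delta$ is a finite family of subsets of a vertex set closed under taking subsets; $\mathcal{F}(\Delta)$ is its set of facets (maximal faces), $\dim(A)=|A|-1$. $\Delta$ is nonpure if its facets do not all have the same dimension. A linear order on $\mathcal{F}(\Delta)$ is written $F_1,\dots,F_t$, meaning $F_i\succ F_j$ iff $i<j$. Such an order is a strong shelling order if for every $1\le i<j\le t$ there exists $k$ with $1\le k<j$ such that $|F_j\setminus F_k|=1$, $F_j\setminus F_k\subseteq F_j\setminus F_i$, and $F_k\setminus F_j\subseteq F_i$; $\Delta$ is strongly shellable if such an order exists. Given a linear order $\succ$ on $\mathcal{F}(\Delta)$, the induced dimension-related order $\vdash_\succ$ is defined by $F\vdash_\succ G$ iff either $\dim F>\dim G$, or $\dim F=\dim G$ and $F\succ G$. For another linear order $\succ'$ on $\mathcal{F}(\Delta)$, an ordered pair $(F,G)$ of facets is a relative inverse pair with respect to $\succ$ if $F\vdash_\succ G$ and $G\succ' F$; $\operatorname{Inv}_\succ(\succ')$ denotes the set of these pairs, and $\operatorname{Inv}(\succ):=\operatorname{Inv}_\succ(\succ)$, i.e. with $\succ: F_1,\dots,F_t$, $(F_i,F_j)\in\operatorname{Inv}(\succ)$ iff $j<i$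 and $\dim F_j<\dim F_i$. *)

(* Defs.v *)
From mathcomp Require Import all_boot all_order all_algebra.

Set Implicit Arguments.
Unset Strict Implicit.
Unset Printing Implicit Defensive.

Definition simplicial_complex (V : finType) (Delta : {set {set V}}) : Prop :=
  forall A B : {set V}, A \in Delta -> B \subset A -> B \in Delta.

Definition facets (V : finType) (Delta : {set {set V}}) : {set {set V}} :=
  [set F | maxset (fun A => A \in Delta) F].

(* Integer-valued, so that the empty face has dimension -1. *)
Definition dim (V : finType) (A : {set V}) : int := (#|A|%:Z - 1)%R.

Definition nonpure (V : finType) (Delta : {set {set V}}) : Prop :=
  exists F G : {set V},
    [/\ F \in facets Delta, G \in facets Delta & dim F <> dim G].

(* A linear order on the facets is given by the list F_1, ..., F_t of all
   facets, each occurring once, with F_i > F_j iff i < j: the larger elements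
   come first.  List positions start at 0. *)
Definition linear_order (V : finType) (Delta : {set {set V}})
    (s : seq {set V}) : Prop :=
  uniq s /\ s =i facets Delta.

(* succ s F G is F > G; since index F s = size s for F outside s, the
   membership test makes it a relation between elements of s. *)
Definition succ (V : finType) (s : seq {set V}) (F G : {set V}) : bool :=
  (G \in s) && (index F s < index G s).

Definition strong_shelling_order (V : finType) (Delta : {set {set V}})
    (s : seq {set V}) : Prop :=
  linear_order Delta s /\
  forall i j : nat, i < j -> j < size s ->
    let F := nth set0 s in
    exists k : nat,
      [/\ k < j, #|F j :\: F k| = 1,
          F j :\: F k \subset F j :\: F i & F k :\: F j \subset F i].

Definition strongly_shellable (V : finType) (Delta : {set {set V}}) : Prop :=
  exists s : seq {set V}, strong_shelling_order Delta s.

Definition dim_order (V : finType) (s : seq {set V}) (F G : {set V}) : bool :=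
  (dim G < dim F)%R || (dim F == dim G) && succ s F G.

Definition relative_Inv (V : finType) (Delta : {set {set V}})
    (s s' : seq {set V}) : {set {set V} * {set V}} :=
  [set p | [&& p.1 \in facets Delta, p.2 \in facets Delta,
               dim_order s p.1 p.2 & succ s' p.2 p.1]].

Definition Inv (V : finType) (Delta : {set {set V}}) (s : seq {set V}) :
    {set {set V} * {set V}} :=
  relative_Inv Delta s s.

(* Main.v *)
Require Import Defs.
From mathcomp Require Import all_boot all_order all_algebra.

Set Implicit Arguments.
Unset Strict Implicit.
Unset Printing Implicit Defensive.

(** If [H] precedes [G] in a strong shelling order and [#|G :\: H| = 1], then
    [dim G <= dim H] because facets form an antichain; and the hypothesis on
    [s'] says exactly that [s'] keeps the precedence of [H] over [G] whenever
    [dim G <= dim H].  So let [F] precede [G] in [s'].  If [F] precedes [G] in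
    [s], the witness for [s] still works for [s'].  Otherwise [G] precedes [F]
    in [s]; the witness [H] for that pair precedes [F], hence [G], in [s'] and
    lies between [G] and [F], so induction on [#|G :\: F|] applies to [H]. *)

Section StrongShelling.

Context {V : finType} {Delta : {set {set V}}}.
Implicit Types (F G H : {set V}) (s : seq {set V}).

(** The part of the shelling condition that mentions no order: such an [H] serves any order in which
    it precedes [G]. *)
Definition shelling_witness F G H : bool :=
  [&& #|G :\: H| == 1, G :\: H \subset G :\: F & H :\: G \subset F].

Lemma succ_meml s F G : succ s F G -> F \in s.
Proof.
by case/andP=> Gs ltFG; rewrite -index_mem (ltn_trans ltFG) // index_mem.
Qed.

Lemma succ_memr s F G : succ s F G -> G \in s.
Proof. by case/andP. Qed.

Lemma succ_trans s F G H : succ s F G -> succ s G H -> succ s F H.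
Proof.
by case/andP=> _ ltFG /andP[Hs ltGH]; rewrite /succ Hs (ltn_trans ltFG).
Qed.

Lemma succ_asym s F G : succ s F G -> ~~ succ s G F.
Proof. by case/andP=> _ ltFG; rewrite /succ ltnNge ltnW ?andbF. Qed.

Lemma succ_total s F G :
  F \in s -> G \in s -> F != G -> succ s F G || succ s G F.
Proof.
move=> Fs Gs; rewrite /succ Fs Gs /= -neq_ltn.
by apply: contra_neq => /index_inj; apply.
Qed.

(** Positions depend on the list, facets do not: trading [nth] for [succ] lets two orders be
    compared. *)
Lemma strong_shelling_orderP s : linear_order Delta s ->
  strong_shelling_order Delta s <->
  (forall F G, succ s F G ->
    exists2 H, succ s H G & shelling_witness F G H).
Proof.
move=> lin_s; have [uniq_s _] := lin_s; split=> [[_ shell_s] F G | shell_s].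
  move=> FG; have Fs := succ_meml FG; case/andP: FG => Gs ltFG.
  have ltG : index G s < size s by rewrite index_mem.
  have [k [ltk]] := shell_s _ _ ltFG ltG.
  rewrite !nth_index // => card1 sub1 sub2.
  exists (nth set0 s k); last by rewrite /shelling_witness card1 eqxx sub1 sub2.
  by rewrite /succ Gs index_uniq // (ltn_trans ltk).
split=> // i j ltij ltj /=.
have lti := ltn_trans ltij ltj.
have [|H] := shell_s (nth set0 s i) (nth set0 s j).
  by rewrite /succ mem_nth ?index_uniq.
move=> HG; have Hs := succ_meml HG; case/andP: HG => _.
rewrite index_uniq // => ltH /and3P[/eqP card1 sub1 sub2].
by exists (index H s); rewrite nth_index.
Qed.

Lemma facet_subset_eq F G :
  F \in facets Delta -> G \in facets Delta -> F \subset G -> F = G.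
Proof.
rewrite !inE => /maxsetP[_ maxF] /maxsetP[GD _] sFG.
by rewrite (maxF G).
Qed.

Lemma setD_facet_gt0 F G H : G \in facets Delta -> H \in facets Delta ->
  shelling_witness F G H -> 0 < #|H :\: G|.
Proof.
move=> Gf Hf /and3P[/eqP card1 _ _].
rewrite card_gt0 setD_eq0; apply/negP=> /(facet_subset_eq Hf Gf) eqHG.
by rewrite eqHG setDv cards0 in card1.
Qed.

(** Both sets consist of [G :&: H] and a difference; [G :\: H] has one element and [H :\: G] at
    least one. *)
Lemma witness_card_le F G H : G \in facets Delta -> H \in facets Delta ->
  shelling_witness F G H -> #|G| <= #|H|.
Proof.
move=> Gf Hf wH; have := setD_facet_gt0 Gf Hf wH.
case/and3P: wH => /eqP card1 _ _.
by rewrite -(cardsID H G) -(cardsID G H) card1 setIC leq_add2l.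
Qed.

Lemma dim_lt F G : (Defs.dim F < Defs.dim G)%R = (#|F| < #|G|).
Proof. by rewrite /Defs.dim Num.Theory.ltrD2r. Qed.

Lemma dim_eq F G : (Defs.dim F == Defs.dim G) = (#|F| == #|G|).
Proof. by rewrite /Defs.dim (inj_eq (GRing.addIr _)). Qed.

Lemma relative_Inv_succ s s' F G :
    linear_order Delta s -> linear_order Delta s' ->
    relative_Inv Delta s s' \subset Inv Delta s ->
  #|G| <= #|F| -> succ s F G -> succ s' F G.
Proof.
move=> [_ mem_s] [_ mem_s'] /subsetP sub_Inv leGF FG.
have Ff : F \in facets Delta by rewrite -mem_s (succ_meml FG).
have Gf : G \in facets Delta by rewrite -mem_s (succ_memr FG).
have neqFG : F != G.
  by apply/eqP=> eqFG; move: FG; rewrite eqFG /succ ltnn andbF.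
have /orP[//|GF'] : succ s' F G || succ s' G F.
  by apply: succ_total; rewrite ?mem_s'.
have /sub_Inv : (F, G) \in relative_Inv Delta s s'.
  (* As [FG] settles ties, [dim_order s F G] reduces to [#|G| <= #|F|]. *)
  by rewrite inE Ff Gf /dim_order dim_lt dim_eq FG GF' !andbT eq_sym orbC
             -leq_eqVlt leGF.
by rewrite inE (negbTE (succ_asym FG)) !andbF.
Qed.

(** The hypothesis gives [F :&: G \subset H] and [H \subset F :|: G], which is symmetric in [F] and
    [G]. *)
Lemma shelling_witness_between F G H :
  shelling_witness G F H -> G :\: H \subset G :\: F /\ H :\: G \subset F.
Proof.
case/and3P=> _ /subsetP sFH /subsetP sHF; split; apply/subsetP=> x;
  rewrite !inE => /andP[].
  move=> xH xG; rewrite xG andbT; apply/negP=> xF.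
  by have := sFH x; rewrite !inE xH xF xG => /(_ isT).
move=> xG xH; apply: contraNT xG => xF.
by apply: sHF; rewrite inE xF.
Qed.

End StrongShelling.

Theorem theorem2p8 (V : finType) (Delta : {set {set V}}) (s : seq {set V}) :
  simplicial_complex Delta ->
  nonpure Delta ->
  strongly_shellable Delta ->
  strong_shelling_order Delta s ->
  forall s' : seq {set V},
    linear_order Delta s' ->
    relative_Inv Delta s s' \subset Inv Delta s ->
    strong_shelling_order Delta s'.
Proof.
move=> _ _ _ shell_s s' lin_s' sub_Inv.
have lin_s : linear_order Delta s by case: shell_s.
move/(strong_shelling_orderP lin_s): shell_s => shell_s.
apply/(strong_shelling_orderP lin_s') => F G.
have facet_s A : A \in s -> A \in facets Delta by case: lin_s => _ ->.
(* The nonemptiness of [H :\: B] is kept for the strict decrease in the induction. *)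
have witness_s' A B : succ s A B ->
    exists2 H, succ s' H B & shelling_witness A B H /\ 0 < #|H :\: B|.
  move=> AB; have [H HB wH] := shell_s A B AB.
  have Bf := facet_s _ (succ_memr HB); have Hf := facet_s _ (succ_meml HB).
  exists H; last by split=> //; exact: setD_facet_gt0 Bf Hf wH.
  exact: relative_Inv_succ sub_Inv (witness_card_le Bf Hf wH) HB.
have [n] := ubnP #|G :\: F|; elim: n F => // n IHn F ltn FG'.
have mem_s A : A \in s' -> A \in s.
  by case: lin_s lin_s' => _ eq_s [_ eq_s']; rewrite eq_s eq_s'.
have neqFG : F != G.
  by apply/eqP=> eqFG; move: FG'; rewrite eqFG /succ ltnn andbF.
have /orP[/witness_s'[H HG [wH _]] | GF] : succ s F G || succ s G F.
- exact: succ_total (mem_s _ (succ_meml FG')) (mem_s _ (succ_memr FG')) neqFG.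
- by exists H.
have [H HF' [wH gt0]] := witness_s' _ _ GF.
have [sGH sHG] := shelling_witness_between wH.
have [|K KG' /and3P[card1 sGK sKG]] := IHn H _ (succ_trans HF' FG').
  (* Strictness: any [x] in [H :\: F] lies in [G] by [wH], hence in [G :\: F] but not in
     [G :\: H]. *)
  rewrite -ltnS (leq_trans _ ltn) // ltnS proper_card // properE sGH /=.
  have [x] := card_gt0P gt0; rewrite inE => /andP[xF xH].
  case/and3P: wH => _ _ /subsetP/(_ x); rewrite inE xF xH => /(_ isT) xG.
  by apply/subsetPn; exists x; rewrite !inE ?xF ?xH ?xG.
exists K => //; apply/and3P; split=> //; first exact: subset_trans sGK sGH.
(* [K :\: G] lies in [H] and misses [G], so it lies in [H :\: G], hence in [F]. *)
apply: subset_trans sHG; rewrite subsetD sKG disjoint_sym disjoints_subset.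
by rewrite setCD subsetUr.
Qed.
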